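(* Let $(X_0,Y_1)$ be a given pair of bridge endpoints in $\mathbb{R}^d$ ($X_0$ at time $t=0$, $Y_1$ at time $t=1$), and let $\sigma_t^2:=\int_0^t\beta_\tau\,d\tau$ and $\hat\sigma_t^2:=\int_t^1\beta_\tau\,d\tau$, where $\beta_t$ is the noise schedule described in the context. The SB ODE $dY_t=v_t(Y_t\mid X_0)\,dt$ (defined in the context) has a closed-form posterior: $$v_t(Y_t\mid X_0)=\frac{\beta_t}{\sigma_t^2}\,(Y_t-X_0),$$ and the SB ODE can be discretized as $$Y_t=\frac{\hat\sigma_t^2}{\hat\sigma_t^2+\sigma_t^2}\,X_0+\frac{\sigma_t^2}{\hat\sigma_t^2+\sigma_t^2}\,Y_1 .$$
   Context: Schrödinger bridge (SB) SDE: between a data distribution $p_X$ at $t=0$ and a distribution $p_Y$ at $t=1$, one considers the forward and backward SDEs $dY_t=f_t\,dt+g_t\,dW_t$ with $Y_0\sim\hat\Psi(\cdot,0)$, and $d\hat Y_t=f_t\,dt+g_t\,d\bar W_t$ with $Y_1\sim\Psi(\cdot,1)$. Here $W_t$ is a Wiener process, $\bar W_t$ is its time reversal, and $\Psi,\hat\Psi$ are the Schrödinger bridge potentials, which satisfy $\Psi(\cdot,0)\hat\Psi(\cdot,0)=p_X$ and $\Psi(\cdot,1)\hat\Psi(\cdot,1)=p_Y$. The parameterization used is $f_t:=0$ and $g_t:=\sqrt{\beta_t}$, where $\beta_t$ is a function that increases for $t\in[0,1/2]$ and decreases for $t\in(1/2,1]$. With this choice, given endpoints $(X_0,Y_1)$,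 the law of $Y_t$ is Gaussian with mean $\frac{\hat\sigma_t^2}{\hat\sigma_t^2+\sigma_t^2}X_0+\frac{\sigma_t^2}{\hat\sigma_t^2+\sigma_t^2}Y_1$ and covariance $\frac{\sigma_t^2\hat\sigma_t^2}{\hat\sigma_t^2+\sigma_t^2}\mathbf I$. SB ODE: when $g_t\to0$, these SDEs between $X$ and $Y$ are expressed by an ODE having the same posterior mean as the SB SDE, written $dY_t=v_t(Y_t\mid X_0)\,dt$. This ODE is called the SB ODE, and $v_t$ is the velocity (drift) that determines the speed of transition from $X_0$ to $Y_t$. *)

(* Defs.v *)
From HB Require Import structures.
From mathcomp Require Import all_boot all_order all_algebra.
From mathcomp Require Import all_classical all_reals all_analysis.
Set Implicit Arguments.
Unset Strict Implicit.
Unset Printing Implicit Defensive.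
Import Order.TTheory GRing.Theory Num.Theory.
Import numFieldNormedType.Exports.
Local Open Scope classical_set_scope.
Local Open Scope ring_scope.

(* The increase and decrease are weak, and beta may jump (even blow up at 1/2
   from the right, as long as it is integrable).  For strictly monotone beta,
   positivity inside follows from [0 <= beta]; for weakly monotone beta it is
   what makes the divisions by sigma2 t and the Gaussian kernels meaningful. *)
Definition noise_schedule {R : realType} (beta : R -> R) : Prop :=
  [/\ {in `[0, 2^-1] &, {homo beta : s t / s <= t}},
      {in `]2^-1, 1] &, {homo beta : s t / s <= t >-> t <= s}},
      (forall t, 0 <= t <= 1 -> 0 <= beta t),
      (forall t, 0 < t < 1 -> 0 < beta t)
    & (@lebesgue_measure R).-integrable `[0, 1] (EFin \o beta)].

Definition sigma2 {R : realType} (beta : R -> R) (t : R) : R :=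
  \int[@lebesgue_measure R]_(tau in `[0, t]) beta tau.

Definition hsigma2 {R : realType} (beta : R -> R) (t : R) : R :=
  \int[@lebesgue_measure R]_(tau in `[t, 1]) beta tau.

Definition diffusion {R : realType} (beta : R -> R) (t : R) : R :=
  Num.sqrt (beta t).

(* The solution of dY = g dW has independent increments, the one from s to t
   being the Wiener integral of g: a centred Gaussian with independent
   coordinates, each of variance int_s^t g^2 (the Ito isometry).  This is the
   transition density of one coordinate. *)
Definition sde_kernel {R : realType} (g : R -> R) (s t x y : R) : R :=
  normal_pdf x
    (Num.sqrt (\int[@lebesgue_measure R]_(tau in `[s, t]) g tau ^+ 2)) y.

(* Schroedinger potentials of one coordinate for the endpoints (x0, y1): Psihat
   is transported forward from the point mass at x0, and Psi backward from the
   point mass at y1, normalised so that Psi * Psihat is a density. *)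
Definition sb_Psihat {R : realType} (g : R -> R) (x0 t z : R) : R :=
  sde_kernel g 0 t x0 z.

Definition sb_Psi {R : realType} (g : R -> R) (x0 y1 t z : R) : R :=
  sde_kernel g t 1 z y1 / sde_kernel g 0 1 x0 y1.

(* [mu] is the posterior of the SB SDE at time t: the law of Y_t given Y_0 = x0
   and Y_1 = y1, with density Psi * Psihat on R^d, the coordinates of the noise
   being independent.  A finite measure on R^d is determined by its values on
   boxes. *)
Definition sb_posterior {R : realType} {d : nat} (g : R -> R) (t : R)
    (x0 y1 : 'rV[R]_d) (mu : probability (d.-tuple R) R) : Prop :=
  forall A : 'I_d -> set R, (forall i, measurable (A i)) ->
    mu [set z | forall i, A i (tnth z i)] =
    (\prod_(i < d) \int[@lebesgue_measure R]_(z in A i)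
      (sb_Psi g (x0 ord0 i) (y1 ord0 i) t z * sb_Psihat g (x0 ord0 i) t z))%:E.

Definition has_mean {R : realType} {d : nat}
    (mu : probability (d.-tuple R) R) (m : 'rV[R]_d) : Prop :=
  forall i : 'I_d, (\int[mu]_z (tnth z i)%:E = (m ord0 i)%:E)%E.

(* Weak convergence to the point mass at m, as eps decreases to 0. *)
Definition concentrates {R : realType} {d : nat}
    (mu : R -> probability (d.-tuple R) R) (m : 'rV[R]_d) : Prop :=
  forall delta : R, 0 < delta ->
    mu eps [set z | exists i, delta <= `|tnth z i - m ord0 i|]
      @[eps --> 0^'+] --> 0%E.

(* dY_t = v_t(Y_t | x0) dt on [0, 1].  Since beta is piecewise monotone it has
   countably many discontinuities, at which Y need not be differentiable; hence
   solutions are continuous functions with the prescribed derivative off this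
   countable set (everywhere inside, if beta is continuous). *)
Definition ode_solution {R : realType} {d : nat} (beta : R -> R)
    (v : R -> 'rV[R]_d -> 'rV[R]_d -> 'rV[R]_d) (x0 : 'rV[R]_d)
    (Y : R -> 'rV[R]_d) : Prop :=
  {within `[0, 1], continuous Y} /\
  forall t : R, 0 < t < 1 -> {for t, continuous beta} ->
    is_derive t (1 : R) Y (v t (Y t) x0).

(* [v] is the velocity of the SB ODE; [v t y x0] stands for v_t(y | x0) and does
   not see y1.  The limit g -> 0 is taken along the diffusions eps * g, g being
   the square root of beta: all the corresponding SDEs have, given the
   endpoints, the posterior mean Y t, and their posteriors shrink to the point
   Y t. *)
Definition SB_ODE {R : realType} {d : nat} (beta : R -> R)
    (v : R -> 'rV[R]_d -> 'rV[R]_d -> 'rV[R]_d) : Prop :=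
  forall x0 y1 : 'rV[R]_d, exists Y : R -> 'rV[R]_d,
    [/\ Y 0 = x0, Y 1 = y1, ode_solution beta v x0 Y &
      forall t : R, 0 < t < 1 ->
        exists mu : R -> probability (d.-tuple R) R,
          (forall eps : R, 0 < eps ->
             sb_posterior (fun s => eps * diffusion beta s) t x0 y1 (mu eps) /\
             has_mean (mu eps) (Y t)) /\
          concentrates mu (Y t)].

(* Main.v *)
(* The posterior of the SB SDE at time t is Gaussian: completing the square in
   Psi * Psihat gives the mean (hsigma2 x0 + sigma2 y1) / (hsigma2 + sigma2) and
   the variance eps^2 sigma2 hsigma2 / (hsigma2 + sigma2).  The mean does not
   depend on eps and the variance vanishes with eps, so the path of the SB ODE
   has to be t |-> x0 + (sigma2 t / sigma2 1) (y1 - x0).  Differentiating it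
   gives the velocity, which is then determined everywhere because, as y1
   varies, these paths reach every point y at every interior time.  If Y solves
   the ODE, then (Y - x0) / sigma2 is continuous on (0, 1] with zero derivative
   off the countable set of discontinuities of beta, hence constant. *)
Require Import Defs.
From HB Require Import structures.
From mathcomp Require Import all_boot all_order all_algebra.
From mathcomp Require Import all_classical all_reals all_analysis.
From mathcomp Require Import measurable_realfun ring.
Import Order.TTheory GRing.Theory Num.Theory.
Import numFieldNormedType.Exports.
Local Open Scope classical_set_scope.
Local Open Scope ring_scope.

Set Implicit Arguments.
Unset Strict Implicit.
Unset Printing Implicit Defensive.

(** * Zero derivative off a countable set *)

(** A nonempty open interval has positive Lebesgue measure, a countable set has measure zero. *)
Lemma itv_not_subset_countable (R : realType) (a b : R) (A : set R) :
  a < b -> countable A -> exists2 y, a < y < b & ~ A y.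
Proof.
move=> ab cA; apply/not_exists2P => H.
have sub : `]a, b[ `<=` A.
  by move=> y /=; rewrite in_itv/= => yab; case: (H y) => // /contrapT.
have /countable_lebesgue_measure0 : countable `]a, b[%classic.
  exact: sub_countable (subset_card_le sub) cA.
rewrite lebesgue_measure_itv/= lte_fin ab -EFinB => -[] /eqP.
by rewrite subr_eq0 gt_eqF.
Qed.

(* If g b < g a, pick a level y between them that g does not take on D; at the
   last point c of [a, b] where g is at least y, g c = y, so c is not in D, but
   g cannot have a positive derivative at c. *)
Lemma le_derive_gt0_countable (R : realType) (g : R -> R) (a b : R)
    (D : set R) : a <= b -> countable D -> {within `[a, b], continuous g} ->
  (forall x, a < x < b -> ~ D x -> exists2 d, is_derive x 1 g d & 0 < d) ->
  g a <= g b.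
Proof.
move=> ab cD cg dg; rewrite leNgt; apply/negP => gba.
have [y /andP[gby yga] nDy] :
    exists2 y, g b < y < g a & ~ (g @` D) y.
  apply: itv_not_subset_countable => //.
  exact: sub_countable (card_image_le _ _) cD.
pose S := [set x | a <= x <= b /\ y <= g x].
have Sa : S a by split; [rewrite lexx ab|exact: ltW].
have supS : has_sup S by split; [exists a|exists b => x [/andP[]]].
pose c := sup S.
have ac : a <= c by apply: ub_le_sup => //; case: supS.
have cb : c <= b by apply: ge_sup; [exists a|move=> x [/andP[]]].
have cgc : g x @[x --> within `[a, b] (nbhs c)] --> g c.
  have := cg c; rewrite /continuous_at nbhs_subspace_in//=.
  by rewrite in_itv/= ac cb.
have ygc : y <= g c.
  rewrite leNgt; apply/negP => gcy.
  have /nbhs_ballP[e /= e0 He] :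
    nbhs c (fun x => `[a, b]%classic x -> g x < y)
    by exact: (cvgr_lt _ cgc _ gcy).
  have [x [xab yx] xc] := sup_adherent e0 supS.
  have xlec : x <= c by apply: ub_le_sup => //; case: supS.
  suff : g x < y by rewrite ltNge yx.
  apply: He; last by rewrite /= in_itv.
  by rewrite /ball/= ger0_norm ?subr_ge0// ltrBlDl -ltrBlDr.
have cltb : c < b.
  rewrite lt_neqAle cb andbT; apply/negP => /eqP cbE.
  by move: ygc; rewrite cbE leNgt gby.
have gx x : c < x <= b -> g x < y.
  move=> /andP[cx xb]; rewrite ltNge; apply/negP => ygx.
  suff : x <= c by rewrite leNgt cx.
  apply: ub_le_sup; first by case: supS.
  by split => //; rewrite xb (le_trans ac (ltW cx)).
have gcE : g c = y.
  apply/eqP; rewrite eq_le ygc andbT leNgt; apply/negP => ygcl.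
  have /nbhs_ballP[e /= e0 He] :
    nbhs c (fun x => `[a, b]%classic x -> y < g x)
    by exact: (cvgr_gt _ cgc _ ygcl).
  (* A point to the right of [c], within [e] of it and not beyond [b]: continuity would put [g x]
     above [y], while [gx] puts it below. *)
  pose x := c + Num.min (e / 2) (b - c).
  have m0 : 0 < Num.min (e / 2) (b - c) by rewrite lt_min divr_gt0//= subr_gt0.
  have xb : x <= b by rewrite /x -lerBrDl ge_min lexx orbT.
  have cx : c < x by rewrite /x ltrDl.
  have := gx x; rewrite cx xb => /(_ isT); apply/negP; rewrite -leNgt ltW//.
  apply: He; last by rewrite /= in_itv/= xb (le_trans ac (ltW cx)).
  rewrite /ball/= /x opprD addNKr normrN gtr0_norm// gt_min ltr_pdivrMr//.
  by rewrite ltr_pMr// ltr1n.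
have altc : a < c.
  rewrite lt_neqAle ac andbT; apply/negP => /eqP acE.
  by move: yga; rewrite acE gcE ltxx.
have nDc : ~ D c by move=> Dc; apply: nDy; exists c.
have [d dgc d0] := dg c (introT andP (conj altc cltb)) nDc.
have /cvg_ex[l] := @ex_derive _ _ _ _ _ _ _ dgc.
move=> gcl; have ld : l = d.
  by rewrite -(@derive_val _ _ _ _ _ _ _ dgc); apply/esym/cvg_lim.
rewrite {}ld in gcl.
have /nbhs_ballP[e /= e0 He] : nbhs (0 : R)
    (fun h => h != 0 -> 0 < h^-1 *: (g (h *: 1 + c) - g c))
    by exact: (cvgr_gt _ gcl _ d0).
pose h := Num.min (e / 2) (b - c).
have h0 : 0 < h by rewrite lt_min divr_gt0//= subr_gt0.
have : 0 < h^-1 *: (g (h *: 1 + c) - g c).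
  apply: He; last by rewrite gt_eqF.
  rewrite /ball/= sub0r normrN gtr0_norm// gt_min ltr_pdivrMr//.
  by rewrite ltr_pMr// ltr1n.
rewrite /GRing.scale/= pmulr_rgt0 ?invr_gt0// subr_gt0 mulr1 gcE.
apply/negP; rewrite -leNgt ltW//; apply: gx; rewrite ltrDr h0/=.
by rewrite -lerBrDr ge_min lexx orbT.
Qed.

(** Adding a small linear term [k * x] turns the zero derivative into a positive one, so the
    previous lemma applies; as [k] is arbitrary, [f] does not decrease from [a] to [b], and neither
    does [- f]. *)
Lemma derive0_countable_cst (R : realType) (f : R -> R) (a b : R)
    (D : set R) : a <= b -> countable D -> {within `[a, b], continuous f} ->
  (forall x, a < x < b -> ~ D x -> is_derive x (1 : R) f 0) ->
  f a = f b.
Proof.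
move=> ab cD cf df.
have key (h : R -> R) : {within `[a, b], continuous h} ->
    (forall x, a < x < b -> ~ D x -> is_derive x (1 : R) h 0) -> h a <= h b.
  move=> ch dh; apply/ler_addgt0Pr => e e0.
  (* Chosen so that [k * (b - a) <= e]; the added 1 keeps the denominator positive when [a = b]. *)
  pose k := e / (b - a + 1).
  have ba1 : 0 < b - a + 1 by rewrite ltr_wpDl// subr_ge0.
  have k0 : 0 < k by rewrite divr_gt0.
  suff : h a + k * a <= h b + k * b.
    rewrite -lerBrDr -addrA -mulrBr => /le_trans; apply.
    by rewrite lerD2l /k mulrAC ler_pdivrMr// ler_pM2l// lerDl.
  apply: (@le_derive_gt0_countable _ (fun x => h x + k * x) _ _ D) => //.
    move=> x; apply: cvgD; first exact: ch.
    apply: continuous_subspaceT => {}x.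
    by apply: cvgM; [exact: cvg_cst|exact: cvg_id].
  move=> x xab nDx; exists k => //.
  have dhx := dh x xab nDx.
  have : is_derive x (1 : R) (h + k *: id) (0 + k *: 1).
    by apply: is_deriveD.
  by rewrite add0r /GRing.scale/= mulr1.
apply/eqP; rewrite eq_le key//=.
rewrite -lerN2; apply: (key (fun x => - f x)).
  by move=> x; apply: cvgN; exact: cf.
move=> x xab nDx; rewrite -oppr0; apply: is_deriveN; exact: df.
Qed.

(** * Noise schedules *)

(** A monotone function has both one-sided limits at interior points, so each discontinuity there is
    a jump, and jumps are countable. *)
Lemma nondecreasing_countable_not_continuous (R : realType) (f : R -> R)
    (a b : R) : {in `[a, b] &, {homo f : x y / x <= y}} ->
  countable [set x | a < x < b /\ ~ {for x, continuous f}].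
Proof.
move=> ndf; apply: sub_countable (discontinuity_countable ndf).
apply: subset_card_le => x [/andP[ax xb] ncx]; split.
  by rewrite in_itv/= ax.
have xab : x \in `[a, b] by rewrite in_itv/= !ltW.
have cl : cvg (f y @[y --> x^'-]).
  apply: nondecreasing_at_left_is_cvgr.
    near=> z => u v; rewrite !in_itv/= => /andP[zu ux] /andP[zv vx]; apply: ndf.
      rewrite in_itv/= (ltW (lt_trans ux xb)) andbT (le_trans _ (ltW zu))//.
      by near: z; exact: nbhs_left_ge.
    rewrite in_itv/= (ltW (lt_trans vx xb)) andbT (le_trans _ (ltW zv))//.
    by near: z; exact: nbhs_left_ge.
  near=> z; exists (f x) => _ /= [u + <-]; rewrite in_itv/= => /andP[zu ux].
  apply: ndf => //; last exact: ltW.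
  rewrite in_itv/= (ltW (lt_trans ux xb)) andbT (le_trans _ (ltW zu))//.
  by near: z; exact: nbhs_left_ge.
have cr : cvg (f y @[y --> x^'+]).
  apply: nondecreasing_at_right_is_cvgr.
    near=> z => u v; rewrite !in_itv/= => /andP[xu uz] /andP[xv vz]; apply: ndf.
      rewrite in_itv/= (ltW (lt_trans ax xu))/= (le_trans (ltW uz))//.
      by near: z; exact: nbhs_right_le.
    rewrite in_itv/= (ltW (lt_trans ax xv))/= (le_trans (ltW vz))//.
    by near: z; exact: nbhs_right_le.
  near=> z; exists (f x) => _ /= [u + <-]; rewrite in_itv/= => /andP[xu uz].
  apply: ndf => //; last exact: ltW.
  rewrite in_itv/= (ltW (lt_trans ax xu))/= (le_trans (ltW uz))//.
  by near: z; exact: nbhs_right_le.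
(* If the two one-sided limits were equal, monotonicity would squeeze [f x] to their common
   value. *)
split => //; apply/eqP => lr; apply: ncx; apply/left_right_continuousP.
have lx : lim (f y @[y --> x^'-]) <= f x.
  apply: limr_le => //; near=> z; apply: ndf => //.
  rewrite in_itv/=; apply/andP; split; first by near: z; exact: nbhs_left_ge.
  by rewrite (le_trans _ (ltW xb))//; near: z; exact: nbhs_left_le.
have xr : f x <= lim (f y @[y --> x^'+]).
  apply: limr_ge => //; near=> z; apply: ndf => //.
  rewrite in_itv/=; apply/andP; split; last by near: z; exact: nbhs_right_le.
  by rewrite (le_trans (ltW ax))//; near: z; exact: nbhs_right_ge.
have fxE : f x = lim (f y @[y --> x^'-]).
  by apply/eqP; rewrite eq_le lx andbT lr.
by split; rewrite fxE// lr.
Unshelve. all: by end_near. Qed.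

(** If the integral were zero, [f] would vanish almost everywhere, yet it is positive on the
    non-null set []a, b[]. *)
Lemma Rintegral_itv_gt0 (R : realType) (f : R -> R) (a b : R) : a < b ->
  (@lebesgue_measure R).-integrable `[a, b] (EFin \o f) ->
  (forall x, a <= x <= b -> 0 <= f x) -> (forall x, a < x < b -> 0 < f x) ->
  0 < \int[@lebesgue_measure R]_(x in `[a, b]) f x.
Proof.
move=> ab intf f0 fgt0; rewrite lt_neqAle Rintegral_ge0 ?andbT; last first.
  by move=> x /=; rewrite in_itv/=; exact: f0.
apply/eqP => /esym I0.
have : (\int[@lebesgue_measure R]_(x in `[a, b]) `|(f x)%:E| = 0)%E.
  transitivity (\int[@lebesgue_measure R]_(x in `[a, b]) (f x)%:E)%E.
    apply: eq_integral => x; rewrite inE/= in_itv/= => /f0 ?.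
    by rewrite ger0_norm.
  rewrite -[LHS]fineK; last exact: integrable_fin_num.
  by congr (_%:E).
move/ae_eq_integral_abs => /(_ (measurable_itv _) (measurable_int _ intf)).
case=> N [mN N0 subN].
have : (@lebesgue_measure R `]a, b[ <= 0)%E.
  rewrite -N0; apply: le_measure; rewrite ?inE//.
  move=> x /=; rewrite in_itv/= => xab; apply: subN => /= H.
  have /H /eqP : x \in `[a, b] by rewrite in_itv/= !ltW//; case/andP: xab.
  by rewrite eqe gt_eqF ?fgt0.
by rewrite lebesgue_measure_itv/= lte_fin ab -EFinB lee_fin leNgt subr_gt0 ab.
Qed.

Section schedule.
Variables (R : realType) (beta : R -> R).
Hypothesis hbeta : noise_schedule beta.

Local Notation mu := (@lebesgue_measure R).

Lemma beta_integrable (a b : R) : 0 <= a -> b <= 1 ->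
  mu.-integrable `[a, b] (EFin \o beta).
Proof.
move=> a0 b1; case: hbeta => _ _ _ _; apply: integrableS => //.
by apply: subset_itv; rewrite bnd_simp.
Qed.

Lemma sigma2_split (s t : R) : 0 <= s -> s <= t -> t <= 1 ->
  sigma2 beta t = sigma2 beta s +
    \int[mu]_(tau in `[s, t]) beta tau.
Proof.
move=> s0 st t1; rewrite /sigma2 -(@Rintegral_itv_obnd_cbnd _ s (BRight t)); last first.
  apply: integrableS (beta_integrable s0 t1) => //.
  by apply: subset_itvr; rewrite bnd_simp.
rewrite -(@Rintegral_itvB _ _ (BLeft 0))// ?bnd_simp// 1?addrC ?subrK//.
all: exact: beta_integrable.
Qed.

Lemma sigma2D_hsigma2 (t : R) : 0 <= t <= 1 ->
  sigma2 beta t + hsigma2 beta t = sigma2 beta 1.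
Proof. by move=> /andP[t0 t1]; rewrite (@sigma2_split t 1). Qed.

Lemma sigma2_0 : sigma2 beta 0 = 0.
Proof. by rewrite /sigma2 set_itv1 Rintegral_set1. Qed.

Lemma Rintegral_beta_gt0 (a b : R) : 0 <= a -> a < b -> b <= 1 ->
  0 < \int[mu]_(tau in `[a, b]) beta tau.
Proof.
move=> a0 ab b1; case: hbeta => _ _ b_ge0 b_gt0 _.
apply: Rintegral_itv_gt0 => //; first exact: beta_integrable.
  move=> x /andP[ax xb]; apply: b_ge0.
  by rewrite (le_trans a0 ax) (le_trans xb b1).
move=> x /andP[ax xb]; apply: b_gt0.
by rewrite (le_lt_trans a0 ax) (lt_le_trans xb b1).
Qed.

Lemma sigma2_gt0 (t : R) : 0 < t -> t <= 1 -> 0 < sigma2 beta t.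
Proof. by move=> t0 t1; exact: Rintegral_beta_gt0. Qed.

Lemma hsigma2_gt0 (t : R) : 0 <= t -> t < 1 -> 0 < hsigma2 beta t.
Proof. by move=> t0 t1; exact: Rintegral_beta_gt0. Qed.

(** The first fundamental theorem of calculus, which needs continuity of [beta] only at [t]. *)
Lemma is_derive_sigma2 (t : R) : 0 < t < 1 -> {for t, continuous beta} ->
  is_derive t (1 : R) (sigma2 beta) (beta t).
Proof.
move=> /andP[t0 t1] ct.
have [dF dE] := continuous_FTC1_closed t1 (beta_integrable (lexx 0) (lexx 1)) t0 ct.
by apply: DeriveDef => //; rewrite -derive1E.
Qed.

Lemma sigma2_continuous : {within `[0, 1], continuous (sigma2 beta)}.
Proof. exact: parameterized_integral_continuous (beta_integrable _ _). Qed.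

(** These are the interior times at which the ODE prescribes no derivative; countability lets
    [derive0_countable_cst] ignore them. *)
Lemma beta_countable_not_continuous :
  countable [set t | 0 < t < 1 /\ ~ {for t, continuous beta}].
Proof.
case: hbeta => ndb nib _ _ _.
(* beta may be unbounded to the right of 1/2, so the decreasing part is cut into
   the intervals [1/2 + 1/(k+1), 1]. *)
pose B n := match n with
  | 0 => [set t | 0 < t < 2^-1 /\ ~ {for t, continuous beta}]
  | 1 => [set 2^-1]
  | k.+2 => [set t | 2^-1 + k.+1%:R^-1 < t < 1 /\
              ~ {for t, continuous (fun x => - beta x)}]
  end.
apply: (@sub_countable _ _ _ (\bigcup_n B n)); last first.
  apply: bigcup_countable => // -[|[|k]] _ /=; first 2 last.
  - apply: nondecreasing_countable_not_continuous => x y.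
    rewrite !in_itv/= => /andP[nx x1] /andP[ny y1] xy; rewrite lerN2.
    apply: nib => //; rewrite in_itv/= ?x1 ?y1 andbT.
      by rewrite (lt_le_trans _ nx)// ltrDl invr_gt0.
    by rewrite (lt_le_trans _ ny)// ltrDl invr_gt0.
  - exact: nondecreasing_countable_not_continuous.
  - exact: countable1.
apply: subset_card_le => t [/andP[t0 t1] nct].
have [th|th|->] := ltgtP t 2^-1; last by exists 1.
  by exists 0 => //; split => //; rewrite t0.
have /ltr_add_invr[k kt] := th.
exists k.+2 => //; split; first by rewrite kt.
move=> ct; apply: nct; rewrite (_ : beta = - (fun x => - beta x)).
  exact: continuousN.
by apply/funext => x; rewrite fctE opprK.
Qed.

End schedule.

(** * The bridge posterior *)

Lemma normal_pdf_sqrtE (R : realType) (m v x : R) : 0 < v ->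
  normal_pdf m (Num.sqrt v) x =
  (Num.sqrt (v * (pi *+ 2)))^-1 * expR (- (x - m) ^+ 2 / (v *+ 2)).
Proof.
move=> v0; rewrite normal_pdfE ?gt_eqF ?sqrtr_gt0// /normal_peak /normal_fun.
by rewrite sqr_sqrtr ?ltW// (mulrnAr v pi).
Qed.

(** Completing the square in [z]: the transition density from [x] to [y] in the denominator absorbs
    exactly the terms free of [z]. *)
Lemma bridge_exponent (F : fieldType) (a b x y z : F) :
  a != 0 -> b != 0 -> b + a != 0 -> (2 : F) != 0 ->
  - (y - z) ^+ 2 / (b *+ 2) - - (y - x) ^+ 2 / ((a + b) *+ 2)
    + - (z - x) ^+ 2 / (a *+ 2) =
  - (z - (b / (b + a) * x + a / (b + a) * y)) ^+ 2 / (a * b / (b + a) *+ 2).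
Proof.
move=> a0 b0 ab0 n2; field.
by rewrite ?(addrC a b) a0 b0 ab0 n2.
Qed.

(** Bayes' rule for a centred Gaussian step of variance [a] followed by an independent one of
    variance [b], conditioned on the end point [y]. Peaks and exponentials are matched
    separately. *)
Lemma normal_pdf_bridge (R : realType) (a b x y z : R) : 0 < a -> 0 < b ->
  normal_pdf z (Num.sqrt b) y / normal_pdf x (Num.sqrt (a + b)) y *
    normal_pdf x (Num.sqrt a) z =
  normal_pdf (b / (b + a) * x + a / (b + a) * y)
    (Num.sqrt (a * b / (b + a))) z.
Proof.
move=> a0 b0; have ab0 : 0 < a + b by exact: addr_gt0.
have ab0' : a + b != 0 by rewrite gt_eqF.
have ba0' : b + a != 0 by rewrite addrC.
have a0' : a != 0 by rewrite gt_eqF.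
have b0' : b != 0 by rewrite gt_eqF.
have v0 : 0 < a * b / (b + a) by rewrite divr_gt0 ?mulr_gt0// addrC.
rewrite !normal_pdf_sqrtE//.
set P := pi *+ 2; have P0 : 0 < P by rewrite pmulrn_lgt0// pi_gt0.
set v := a * b / (b + a) in v0 *.
have peak : (Num.sqrt (b * P))^-1 * Num.sqrt ((a + b) * P) *
    (Num.sqrt (a * P))^-1 = (Num.sqrt (v * P))^-1.
  have p0 c : 0 < c -> Num.sqrt (c * P) != 0.
    by move=> c0; rewrite gt_eqF// sqrtr_gt0 mulr_gt0.
  (* The peaks match because [(a + b) * v = a * b]. *)
  have E : Num.sqrt ((a + b) * P) * Num.sqrt (v * P) =
      Num.sqrt (b * P) * Num.sqrt (a * P).
    rewrite -!sqrtrM ?mulr_ge0 ?ltW//; congr Num.sqrt.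
    rewrite mulrACA [RHS]mulrACA; congr (_ * _).
    by rewrite /v (addrC a) mulrC divfK// mulrC.
  have -> : Num.sqrt ((a + b) * P) =
      Num.sqrt (b * P) * Num.sqrt (a * P) / Num.sqrt (v * P).
    by rewrite -E mulfK ?p0.
  by rewrite mulrA mulKf ?p0// mulrAC divff ?p0// mul1r.
have expo : expR (- (y - z) ^+ 2 / (b *+ 2)) /
    expR (- (y - x) ^+ 2 / ((a + b) *+ 2)) * expR (- (z - x) ^+ 2 / (a *+ 2)) =
   expR (- (z - (b / (b + a) * x + a / (b + a) * y)) ^+ 2 / (v *+ 2)).
  by rewrite -expRN -!expRD bridge_exponent ?pnatr_eq0.
rewrite -peak -expo invfM invrK.
move: (expR _) (expR _) (expR _) => e1 e2 e3.
move: (Num.sqrt _) (Num.sqrt _) (Num.sqrt _) => p1 p2 p3.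
by rewrite (mulrACA p3^-1) [LHS]mulrACA.
Qed.

Section bridge.
Variables (R : realType) (beta : R -> R).
Hypothesis hbeta : noise_schedule beta.
Local Notation mu := (@lebesgue_measure R).

Lemma Rintegral_diffusion (eps s t : R) : 0 <= s -> t <= 1 ->
  \int[mu]_(tau in `[s, t]) (eps * diffusion beta tau) ^+ 2 =
  eps ^+ 2 * \int[mu]_(tau in `[s, t]) beta tau.
Proof.
move=> s0 t1; rewrite -RintegralZl//; last exact: beta_integrable.
apply: eq_Rintegral => x; rewrite inE/= in_itv/= => /andP[sx xt].
rewrite exprMn /diffusion sqr_sqrtr//.
case: hbeta => _ _ b0 _ _; apply: b0.
by rewrite (le_trans s0 sx) (le_trans xt t1).
Qed.

Definition bridge_mean (t x y : R) : R :=
  hsigma2 beta t / (hsigma2 beta t + sigma2 beta t) * x +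
  sigma2 beta t / (hsigma2 beta t + sigma2 beta t) * y.

Definition bridge_var (t : R) : R :=
  sigma2 beta t * hsigma2 beta t / (hsigma2 beta t + sigma2 beta t).

Lemma bridge_var_gt0 (t : R) : 0 < t < 1 -> 0 < bridge_var t.
Proof.
move=> /andP[t0 t1].
have s0 := sigma2_gt0 hbeta t0 (ltW t1).
have h0 := hsigma2_gt0 hbeta (ltW t0) t1.
by rewrite divr_gt0 ?mulr_gt0 ?addr_gt0.
Qed.

(** Scaling the diffusion by [eps] multiplies both variances by [eps ^+ 2]; this cancels in the
    weights of the mean and leaves a factor [eps] in the standard deviation. *)
Lemma sb_density (eps t x y z : R) : 0 < eps -> 0 < t < 1 ->
  sb_Psi (fun s => eps * diffusion beta s) x y t z *
    sb_Psihat (fun s => eps * diffusion beta s) x t z =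
  normal_pdf (bridge_mean t x y) (eps * Num.sqrt (bridge_var t)) z.
Proof.
move=> e0 /andP[t0 t1]; rewrite /sb_Psi /sb_Psihat /sde_kernel.
rewrite !Rintegral_diffusion ?lexx ?ltW// -/(sigma2 _ _) -/(sigma2 _ _)
  -/(hsigma2 _ _).
have s0 := sigma2_gt0 hbeta t0 (ltW t1).
have h0 := hsigma2_gt0 hbeta (ltW t0) t1.
have e2 : 0 < eps ^+ 2 by rewrite exprn_gt0.
rewrite -(@sigma2D_hsigma2 _ _ hbeta t) ?ltW ?t0// mulrDr.
rewrite normal_pdf_bridge ?mulr_gt0// -mulrDr.
have sh0 : hsigma2 beta t + sigma2 beta t != 0 by rewrite gt_eqF// addr_gt0.
have ediv u : eps ^+ 2 * u / (eps ^+ 2 * (hsigma2 beta t + sigma2 beta t)) =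
    u / (hsigma2 beta t + sigma2 beta t).
  by rewrite -mulf_div divff ?gt_eqF// mul1r.
have -> : Num.sqrt (eps ^+ 2 * sigma2 beta t * (eps ^+ 2 * hsigma2 beta t) /
    (eps ^+ 2 * (hsigma2 beta t + sigma2 beta t))) =
    eps * Num.sqrt (bridge_var t).
  rewrite -[in LHS]mulrA ediv -[in LHS]mulrA sqrtrM ?ltW// sqrtr_sqr gtr0_norm//.
  by rewrite /bridge_var mulrA.
by rewrite !ediv.
Qed.

End bridge.

(** * First moments of the normal distribution *)

Section normal_moments.
Variables (R : realType).
Local Notation mu := (@lebesgue_measure R).

(** Change of variables through the Radon-Nikodym derivative, which agrees almost everywhere with
    [normal_pdf] since both have the same integral over every measurable set. *)
Lemma ge0_integral_normal_prob (m s : R) (f : R -> \bar R) :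
  measurable_fun [set: R] f -> (forall x, (0 <= f x)%E) ->
  (\int[normal_prob m s]_x f x = \int[mu]_x (f x * (normal_pdf m s x)%:E))%E.
Proof.
move=> mf f0; have dom := normal_prob_dominates m s.
have mpdf : measurable_fun [set: R] (EFin \o normal_pdf m s).
  by apply/measurable_EFinP; exact: measurable_normal_pdf.
rewrite -(Radon_Nikodym_SigmaFinite.change_of_variables dom)//.
have iRN := Radon_Nikodym_SigmaFinite.f_integrable dom.
apply: ae_eq_integral => //.
- by apply: emeasurable_funM => //; exact: measurable_int iRN.
- exact: emeasurable_funM.
- apply: ae_eqe_mul2l; apply: integral_ae_eq => //.
  by move=> E _ mE; rewrite -Radon_Nikodym_SigmaFinite.f_integral.
Qed.

(** Provides the primitive from which the first moments are computed. *)
Lemma is_derive_normal_pdf (m s x : R) : s != 0 ->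
  is_derive x (1 : R) (fun z => - (s ^+ 2 * normal_pdf m s z))
    ((x - m) * normal_pdf m s x).
Proof.
move=> s0; rewrite normal_pdfE//= /normal_fun.
apply: is_derive_eq.
rewrite /GRing.scale/=.
move: (normal_peak s) (expR _) => c e.
by field.
Qed.

Lemma cvg_normal_pdfy (m s : R) : s != 0 ->
  normal_pdf m s x @[x --> +oo] --> 0.
Proof.
move=> s0; rewrite normal_pdfE//= /normal_fun.
rewrite -(mulr0 (normal_peak s)); apply: cvgM; first exact: cvg_cst.
(* The scale that reduces the exponential factor to the standard [gauss_fun] after an affine change
   of variable. *)
pose k := Num.sqrt (s ^+ 2 *+ 2).
have k2 : 0 < s ^+ 2 *+ 2 by rewrite pmulrn_lgt0// exprn_even_gt0.
rewrite (_ : (fun x => _) = gauss_fun \o (fun x => k^-1 * (x - m))).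
  apply: cvg_comp (@cvg_gauss_fun R).
  apply: gt0_cvgMry; first by rewrite invr_gt0 sqrtr_gt0.
  exact: cvg_addrr.
apply/funext => x /=; rewrite /gauss_fun exprMn exprVn sqr_sqrtr ?ltW//.
by rewrite mulNr mulrC.
Qed.

(** The primitive [F] vanishes at infinity and equals minus the right-hand side at [m]. *)
Lemma integral_ge_normal_pdf (m s : R) : s != 0 ->
  (\int[mu]_(x in `[m, +oo[) ((x - m) * normal_pdf m s x)%:E =
   (s ^+ 2 * normal_peak s)%:E)%E.
Proof.
move=> s0.
pose F x := - (s ^+ 2 * normal_pdf m s x).
have dF x := is_derive_normal_pdf m x s0.
have cpdf := @continuous_normal_pdf _ m s s0.
rewrite (@ge0_continuous_FTC2y _ _ F m 0).
- rewrite /F normal_pdfE//= /normal_fun subrr expr0n/= oppr0 mul0r expR0.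
  by rewrite mulr1 -EFinB opprK add0r.
- by move=> x mx; rewrite mulr_ge0 ?subr_ge0// normal_pdf_ge0.
- apply: continuous_subspaceT => x; apply: cvgM; last exact: cpdf.
  by apply: cvgB; [exact: cvg_id|exact: cvg_cst].
- rewrite /F -oppr0 -(mulr0 (s ^+ 2)); apply: cvgN; apply: cvgM.
    exact: cvg_cst.
  exact: cvg_normal_pdfy.
- by move=> x _; apply: ex_derive.
- apply: cvg_at_right_filter; apply: cvgN; apply: cvgM; first exact: cvg_cst.
  exact: cpdf.
- by move=> x _; rewrite derive1E; exact: derive_val.
Qed.

(** The reflection [x |-> - x] reduces this to the previous lemma with mean [- m]. *)
Lemma integral_le_normal_pdf (m s : R) : s != 0 ->
  (\int[mu]_(x in `]-oo, m]) ((m - x) * normal_pdf m s x)%:E =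
   (s ^+ 2 * normal_peak s)%:E)%E.
Proof.
move=> s0; rewrite -(integral_ge_normal_pdf (- m) s0) -{1}(opprK m).
rewrite (@ge0_integration_by_substitutionNy _ _ (- m)).
- apply: eq_integral => x _ /=; congr (_%:E).
  rewrite !opprK (addrC m); congr (_ * _).
  by rewrite !normal_pdfE//= /normal_fun -opprD sqrrN opprK.
- apply: continuous_subspaceT => x; apply: cvgM.
    by apply: cvgB; [exact: cvg_cst|exact: cvg_id].
  exact: continuous_normal_pdf.
- move=> x; rewrite opprK in_itv/= => xm.
  by rewrite mulr_ge0 ?normal_pdf_ge0// subr_ge0 ltW.
Qed.

Section center.
Variables (m s : R).
Hypothesis s0 : s != 0.
(** The positive and negative parts of [f] live on opposite sides of [m] and have the same finite
    integral: their difference gives the mean, their sum the first absolute moment. *)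
Let f (x : R) : \bar R := (x - m)%:E.

Let mf : measurable_fun [set: R] f.
Proof. by apply/measurable_EFinP; exact: measurable_funB. Qed.

Let integral_funepos :
  (\int[normal_prob m s]_x f^\+ x = (s ^+ 2 * normal_peak s)%:E)%E.
Proof.
rewrite ge0_integral_normal_prob//; last exact: measurable_funepos.
rewrite -(integral_ge_normal_pdf m)// [RHS]integral_mkcond.
apply: eq_integral => x _; rewrite patchE funeposE /f.
case: ifPn; rewrite ?notin_setE ?inE/= in_itv/= andbT => mx.
  by rewrite max_l// lee_fin subr_ge0.
rewrite max_r ?mul0e// lee_fin subr_le0.
by move/negP: mx; rewrite -ltNge => /ltW.
Qed.

Let integral_funeneg :
  (\int[normal_prob m s]_x f^\- x = (s ^+ 2 * normal_peak s)%:E)%E.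
Proof.
rewrite ge0_integral_normal_prob//; last exact: measurable_funeneg.
rewrite -(integral_le_normal_pdf m)// [RHS]integral_mkcond.
apply: eq_integral => x _; rewrite patchE funenegE /f.
case: ifPn; rewrite ?notin_setE ?inE/= in_itv/= => mx.
  by rewrite ?[(- _)%E]/= ?opprB max_l// lee_fin subr_ge0.
rewrite ?[(- _)%E]/= ?opprB max_r ?mul0e// lee_fin subr_le0.
by move/negP: mx; rewrite -ltNge => /ltW.
Qed.

Lemma integral_normal_prob_abs :
  (\int[normal_prob m s]_x (`|x - m|)%:E =
   (s ^+ 2 * normal_peak s *+ 2)%:E)%E.
Proof.
transitivity (\int[normal_prob m s]_x (f^\+ x + f^\- x))%E.
  apply: eq_integral => x _.
  by rewrite -(congr1 (fun g => g x) (fune_abse f)).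
rewrite ge0_integralD//; last 2 first.
  exact: measurable_funepos.
  exact: measurable_funeneg.
by rewrite [X in (X + _)%E]integral_funepos [X in (_ + X)%E]integral_funeneg.
Qed.

Let integral_center : (\int[normal_prob m s]_x f x = 0)%E.
Proof.
by rewrite integralE integral_funepos integral_funeneg subee.
Qed.

Lemma integrable_normal_prob :
  (normal_prob m s).-integrable [set: R] (fun x => x%:E).
Proof.
have -> : (fun x : R => x%:E) = (f \+ cst m%:E)%E.
  by apply/funext => x /=; rewrite /f -EFinD subrK.
apply: integrableD => //; last exact: finite_measure_integrable_cst.
apply/integrableP; split => //.
by rewrite [ltLHS]integral_normal_prob_abs ltry.
Qed.

Lemma integral_normal_prob_id : (\int[normal_prob m s]_x x%:E = m%:E)%E.
Proof.
transitivity (\int[normal_prob m s]_x (f x + cst m%:E x))%E.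
  by apply: eq_integral => x _ /=; rewrite /f -EFinD subrK.
rewrite integralD//; last exact: finite_measure_integrable_cst.
  by rewrite integral_center add0e integral_cst//= probability_setT mule1.
apply/integrableP; split => //.
by rewrite [ltLHS]integral_normal_prob_abs ltry.
Qed.

End center.
End normal_moments.

(** * Product probabilities on tuples *)

Section tuple_product.
Variable R : realType.
Local Open Scope ereal_scope.

Lemma measurable_box d0 (T : measurableType d0) d (A : 'I_d -> set T) :
  (forall i, measurable (A i)) ->
  measurable [set z : d.-tuple T | forall i, A i (tnth z i)].
Proof.
move=> mA.
rewrite (_ : [set z | _] =
    \bigcap_(i in [set: 'I_d]) ((@tnth d T ^~ i) @^-1` A i)).
  apply: fin_bigcap_measurable => // i _.
  by rewrite -[X in measurable X]setTI; exact: measurable_tnth.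
by apply/seteqP; split => z /= Az; [move=> i _|move=> i]; exact: Az.
Qed.

(** By induction on [d]: the product of the first factor with the measure on the tail is pushed
    forward along cons. For [d = 0] every box is the whole one-point space. *)
Lemma exists_tuple_probability d0 (T : measurableType d0) (t0 : T) d
    (P : 'I_d -> probability T R) :
  exists mu : probability (d.-tuple T) R,
    forall A : 'I_d -> set T, (forall i, measurable (A i)) ->
      mu [set z | forall i, A i (tnth z i)] = \prod_(i < d) P i (A i).
Proof.
elim: d P => [|d IH] P.
  exists (dirac [tuple]) => A mA; rewrite big_ord0.
  rewrite (_ : [set z | _] = setT); first exact: probability_setT.
  by apply/seteqP; split => // z _ [].
have [mu' Hmu'] := IH (fun i => P (lift ord0 i)).
pose h (p : T * d.-tuple T) := [the d.+1.-tuple T of p.1 :: p.2].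
have mh : measurable_fun [set: _] h.
  by apply: measurable_cons; [exact: measurable_fst|exact: measurable_snd].
pose H : {mfun _ >-> _} := HB.pack h (isMeasurableFun.Build _ _ _ _ _ mh).
exists (distribution (P ord0 \x mu') H) => A mA.
rewrite -[LHS]/((P ord0 \x mu') (h @^-1` [set z | forall i, A i (tnth z i)])).
rewrite (_ : _ @^-1` _ = A ord0 `*` [set z | forall i : 'I_d, A (lift ord0 i) (tnth z i)]).
  rewrite product_measure1E//; last first.
    exact: (measurable_box (fun i => mA (lift ord0 i))).
  rewrite big_ord_recl; congr (_ * _).
  exact: (Hmu' (fun i => A (lift ord0 i)) (fun i => mA (lift ord0 i))).
apply/funext => -[x z]; apply/propext; split => /=.
  move=> Az; split; first by have := Az ord0; rewrite tnth0.
  by move=> i; have := Az (lift ord0 i); rewrite tnthS.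
move=> [Ax Az] i; case: (unliftP ord0 i) => [j|] ->.
  by rewrite tnthS.
by rewrite tnth0.
Qed.

End tuple_product.

(** * Marginals, mean and concentration of the posterior *)

Lemma normal_probE (R : realType) (m s : R) (A : set R) : measurable A ->
  normal_prob m s A = (\int[lebesgue_measure]_(z in A) normal_pdf m s z)%:E.
Proof.
move=> mA; rewrite /Rintegral fineK//; apply: integrable_fin_num => //.
by apply: integrableS (integrable_normal_pdf m s).
Qed.

Lemma measure_exists_le d (T : measurableType d) (R : realType)
    (mu : {measure set T -> \bar R}) n (A : 'I_n -> set T) :
  (forall i, measurable (A i)) ->
  (mu [set z | exists i, A i z] <= \sum_(i < n) mu (A i))%E.
Proof.
move=> mA.
(* The family is extended to all naturals by the empty set, the form in which Boole's inequality
   applies. *)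
pose B k := if insub k is Some i then A i else set0.
have BE (i : 'I_n) : B i = A i by rewrite /B valK.
rewrite (_ : [set z | _] = \big[setU/set0]_(i < n) B i).
  rewrite [leRHS](eq_bigr (fun i : 'I_n => mu (B i))); last first.
    by move=> i _; rewrite BE.
  apply: Boole_inequality => k kn.
  by rewrite -[k]/(nat_of_ord (Ordinal kn)) BE.
rewrite -bigcup_mkord; apply/seteqP; split => z /=.
  by move=> [i Aiz]; exists i => /=; [exact: ltn_ord|rewrite BE].
by move=> [k /= kn]; rewrite -[k]/(nat_of_ord (Ordinal kn)) BE; exists (Ordinal kn).
Qed.

Section posterior.
Variables (R : realType) (beta : R -> R).
Hypothesis hbeta : noise_schedule beta.

Section at_time.
Variables (t : R) (d : nat) (x0 y1 : 'rV[R]_d).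
Hypothesis t01 : 0 < t < 1.

Let m (i : 'I_d) := bridge_mean beta t (x0 ord0 i) (y1 ord0 i).
Let sd (eps : R) := eps * Num.sqrt (bridge_var beta t).

Let sd_gt0 eps : 0 < eps -> 0 < sd eps.
Proof. by move=> e0; rewrite mulr_gt0// sqrtr_gt0 bridge_var_gt0. Qed.

Lemma sb_posteriorE (eps : R) (mu : probability (d.-tuple R) R) : 0 < eps ->
  sb_posterior (fun s => eps * diffusion beta s) t x0 y1 mu <->
  (forall A : 'I_d -> set R, (forall i, measurable (A i)) ->
    mu [set z | forall i, A i (tnth z i)] =
    \prod_(i < d) normal_prob (m i) (sd eps) (A i))%E.
Proof.
move=> e0.
have E (A : 'I_d -> set R) : (forall i, measurable (A i)) ->
    (\prod_(i < d) \int[@lebesgue_measure R]_(z in A i)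
      (sb_Psi (fun s => eps * diffusion beta s) (x0 ord0 i) (y1 ord0 i) t z *
       sb_Psihat (fun s => eps * diffusion beta s) (x0 ord0 i) t z))%:E =
    (\prod_(i < d) normal_prob (m i) (sd eps) (A i))%E.
  move=> mA; rewrite -prodEFin; apply: eq_bigr => i _.
  rewrite normal_probE//; congr (_%:E); apply: eq_Rintegral => z _.
  exact: sb_density.
by split => H A mA; rewrite H// E.
Qed.

(** Evaluate on the box with side [B] in direction [i] and the whole line in all others; those other
    factors equal 1. *)
Lemma sb_posterior_marginal (eps : R) (mu : probability (d.-tuple R) R)
    (i : 'I_d) (B : set R) : 0 < eps ->
  sb_posterior (fun s => eps * diffusion beta s) t x0 y1 mu ->
  measurable B ->
  mu [set z | B (tnth z i)] = normal_prob (m i) (sd eps) B.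
Proof.
move=> e0 /(sb_posteriorE _ e0) Hmu mB.
have := Hmu (fun j => if j == i then B else setT).
rewrite (bigD1 i)//= eqxx big1 ?mule1; last first.
  by move=> j /negbTE ->; exact: probability_setT.
move=> <-; last by move=> j; case: ifP.
congr (mu _); apply/seteqP; split => z /=.
  by move=> Bz j; case: eqP => // ->.
by move=> /(_ i); rewrite eqxx.
Qed.

(** The integral of a coordinate is that of the identity against its law, which is the normal
    marginal. *)
Lemma sb_posterior_mean (eps : R) (mu : probability (d.-tuple R) R)
    (i : 'I_d) : 0 < eps ->
  sb_posterior (fun s => eps * diffusion beta s) t x0 y1 mu ->
  (\int[mu]_z (tnth z i)%:E = (m i)%:E)%E.
Proof.
move=> e0 Hmu.
have s0 : sd eps != 0 by rewrite gt_eqF ?sd_gt0.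
(* normal_prob is a measure on measurableTypeR R, whose measurable sets are
   those of R but whose display differs; hence the codomain of X. *)
have mX : measurable_fun setT
    ((fun z => tnth z i) : d.-tuple R -> measurableTypeR R).
  by move=> mD Y mY; exact: (measurable_tnth i mD mY).
pose X : {mfun (d.-tuple R) >-> (measurableTypeR R)} :=
  HB.pack (fun z : d.-tuple R => tnth z i : measurableTypeR R)
    (isMeasurableFun.Build _ _ _ _ _ mX).
have dE (f : measurableTypeR R -> \bar R) :
    (\int[distribution mu X]_x f x = \int[normal_prob (m i) (sd eps)]_x f x)%E.
  by apply: eq_measure_integral => A mA _; exact: sb_posterior_marginal.
rewrite -(integral_normal_prob_id (m i) s0) -dE integral_distribution//.
apply/integrableP; split.
  by apply: measurableT_comp => //; exact: measurable_tnth.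
have := integrable_normal_prob (m i) s0 => /integrableP[_].
by rewrite -dE ge0_integral_distribution//; exact: measurableT_comp.
Qed.

Lemma exists_sb_posterior (eps : R) : 0 < eps ->
  exists mu : probability (d.-tuple R) R,
    sb_posterior (fun s => eps * diffusion beta s) t x0 y1 mu.
Proof.
move=> e0.
(* The normal law is pushed forward along the identity to become a probability on [R] with its own
   display. *)
have mid : measurable_fun setT (idfun : measurableTypeR R -> R).
  by move=> _ Y mY; rewrite setTI.
pose I : {mfun (measurableTypeR R) >-> R} :=
  HB.pack (idfun : measurableTypeR R -> R) (isMeasurableFun.Build _ _ _ _ _ mid).
have [mu Hmu] := @exists_tuple_probability R _ R 0 d
  (fun i => distribution (normal_prob (m i) (sd eps)) I).
by exists mu; apply/sb_posteriorE.
Qed.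

(** A union bound over the coordinates and Markov's inequality for the first absolute moment bound
    the mass away from the mean by a multiple of [eps]. *)
Lemma sb_posterior_concentrates (mu : R -> probability (d.-tuple R) R) :
  (forall eps, 0 < eps ->
    sb_posterior (fun s => eps * diffusion beta s) t x0 y1 (mu eps)) ->
  concentrates mu (\row_i m i).
Proof.
move=> Hmu delta delta0.
pose c := Num.sqrt (bridge_var beta t).
(* A normal law of standard deviation [s] has first absolute moment [2 * s / sqrt (2 * pi)]; here
   [s = eps * c], and Markov's inequality divides by [delta]. *)
pose K := \sum_(i < d) c *+ 2 / Num.sqrt (pi *+ 2) / delta.
have bnd eps : 0 < eps ->
    (mu eps [set z | exists i, (delta <= `|tnth z i - (\row_i m i) ord0 i|)%R] <=
     (eps * K)%:E)%E.
  move=> e0.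
  pose B i : set R := [set x | delta <= `|x - m i|].
  have mB i : measurable (B i).
    rewrite (_ : B i = (fun x => `|x - m i|) @^-1` `[delta, +oo[).
      rewrite -[X in measurable X]setTI; apply: measurableT_comp => //.
      exact: measurable_funB.
    by apply/seteqP; split => x /=; rewrite in_itv/= andbT.
  apply: (@le_trans _ _ (\sum_(i < d) normal_prob (m i) (sd eps) (B i))%E).
    rewrite (eq_bigr (fun i => mu eps [set z | B i (tnth z i)])); last first.
      by move=> i _; rewrite (sb_posterior_marginal _ e0)//; exact: Hmu.
    rewrite (_ : [set z | _] = [set z | exists i, B i (tnth z i)]).
      apply: (@measure_exists_le _ _ _ (mu eps)) => i.
      by rewrite -[X in measurable X]setTI; exact: (measurable_tnth i measurableT (mB i)).
    by apply/seteqP; split => z /= [i iz]; exists i; move: iz; rewrite /B/= mxE.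
  rewrite /K mulr_sumr -sumEFin; apply: lee_sum => i _.
  have sd0 : 0 < sd eps by exact: sd_gt0.
  have mf : measurable_fun [set: measurableTypeR R] (fun x => (x - m i)%:E).
    by apply/measurable_EFinP; exact: measurable_funB.
  (* Markov's inequality in coordinate [i]. *)
  have := le_integral_abse (normal_prob (m i) (sd eps)) measurableT mf delta0.
  rewrite setTI [leRHS](_ : _ = (sd eps ^+ 2 * normal_peak (sd eps) *+ 2)%:E);
    last by apply: integral_normal_prob_abs; rewrite gt_eqF.
  rewrite (_ : [set x | _] = B i)//. rewrite normal_probE//.
  rewrite [X in (_ * X <= _)%E -> _](normal_probE (m i) (sd eps) (mB i)).
  rewrite -EFinM !lee_fin.
  rewrite -ler_pdivlMl// => /le_trans; apply.
  rewrite /normal_peak -(mulrnAr _ pi) sqrtrM ?sqr_ge0// sqrtr_sqr gtr0_norm//.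
  rewrite invfM expr2 mulrACA divff ?gt_eqF// mul1r.
  rewrite /sd -/c.
  by rewrite mulrC -mulrnAl -mulrnAr !mulrA.
apply: (@squeeze_cvge _ _ _ _ (cst 0%E) _ (fun eps => (eps * K)%:E)).
- near=> eps; rewrite measure_ge0/= bnd//.
- exact: cvg_cst.
- apply: cvg_EFin; first exact: nearW.
  rewrite -[X in _ --> X](mul0r K).
  apply: cvg_at_right_filter; apply: cvgM; [exact: cvg_id|exact: cvg_cst].
Unshelve. all: by end_near. Qed.

End at_time.
End posterior.

(** * The SB path *)

Lemma is_derive_mxP (R : realFieldType) (V : normedModType R) (m n : nat)
    (M : V -> 'M[R]_(m, n)) (t v : V) (D : 'M[R]_(m, n)) :
  is_derive t v M D <-> forall i j, is_derive t v (fun x => M x i j) (D i j).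
Proof.
split=> [dM i j|dM].
  have /derivable_mxP dMij : derivable M t v by exact: ex_derive.
  apply: DeriveDef => //.
  by rewrite -(@derive_val _ _ _ _ _ _ _ dM) derive_mx ?mxE//; exact: ex_derive.
have dMt : derivable M t v by apply/derivable_mxP => i j; exact: ex_derive.
apply: DeriveDef => //; rewrite derive_mx//; apply/matrixP => i j.
by rewrite mxE; exact: derive_val.
Qed.

Section sb_path.
Variables (R : realType) (beta : R -> R) (d : nat).
Hypothesis hbeta : noise_schedule beta.
Variables x0 y1 : 'rV[R]_d.

(** Written with [sigma2] alone, so that time enters through a single scalar factor and
    differentiation is immediate. *)
Definition sb_path (t : R) : 'rV[R]_d :=
  x0 + (sigma2 beta t / sigma2 beta 1) *: (y1 - x0).

Let sigma2_1_gt0 : 0 < sigma2 beta 1.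
Proof. exact: sigma2_gt0. Qed.

Lemma sb_pathE (t : R) : 0 <= t <= 1 ->
  sb_path t = (hsigma2 beta t / (hsigma2 beta t + sigma2 beta t)) *: x0
    + (sigma2 beta t / (hsigma2 beta t + sigma2 beta t)) *: y1.
Proof.
move=> t01; have sE := sigma2D_hsigma2 hbeta t01.
rewrite addrC in sE; rewrite /sb_path sE scalerBr.
have -> : hsigma2 beta t = sigma2 beta 1 - sigma2 beta t by rewrite -sE addrK.
by rewrite mulrBl divff ?gt_eqF// scalerBl scale1r addrCA addrC.
Qed.

Lemma sb_path_bridge_mean (t : R) : 0 <= t <= 1 ->
  sb_path t = \row_i bridge_mean beta t (x0 ord0 i) (y1 ord0 i).
Proof.
by move=> t01; apply/rowP => i; rewrite sb_pathE// !mxE.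
Qed.

Lemma sb_path0 : sb_path 0 = x0.
Proof. by rewrite /sb_path sigma2_0 mul0r scale0r addr0. Qed.

Lemma sb_path1 : sb_path 1 = y1.
Proof. by rewrite /sb_path divff ?gt_eqF// scale1r addrC subrK. Qed.

Lemma sb_path_continuous : {within `[0, 1], continuous sb_path}.
Proof.
move=> t; apply: cvgD; first exact: cvg_cst.
apply: cvgZr_tmp; apply: cvgMr_tmp; exact: sigma2_continuous.
Qed.

(** The derivative is [beta t / sigma2 beta 1] times [y1 - x0], and [y1 - x0] is a multiple of
    [sb_path t - x0]; this eliminates [y1]. *)
Lemma sb_path_is_derive (t : R) : 0 < t < 1 -> {for t, continuous beta} ->
  is_derive t (1 : R) sb_path ((beta t / sigma2 beta t) *: (sb_path t - x0)).
Proof.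
move=> t01 ct; apply/is_derive_mxP => i j.
have ds := is_derive_sigma2 hbeta t01 ct.
rewrite (_ : (fun x => _) = cst (x0 i j) +
    ((y1 - x0) i j / sigma2 beta 1) \*: sigma2 beta); last first.
  apply/funext => x /=; rewrite /sb_path !mxE.
  rewrite fctE/=; congr (_ + _).
  by rewrite -mulrA (mulrC _^-1) [LHS]mulrC.
have := is_deriveD (is_derive_cst (x0 i j) t 1)
  (is_deriveZ ((y1 - x0) i j / sigma2 beta 1) ds).
move/is_derive_eq; apply.
have s0 : sigma2 beta t != 0.
  by case/andP: t01 => t0 t1; rewrite gt_eqF// sigma2_gt0// ltW.
rewrite /sb_path (addrC x0) addrK scalerA mulrA divfK// !mxE.
by rewrite add0r -mulrA (mulrC _^-1) [RHS]mulrC.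
Qed.

End sb_path.

Lemma sb_path_unique (R : realType) (beta : R -> R) (d : nat)
    (x0 y1 : 'rV[R]_d) (Y : R -> 'rV[R]_d) : noise_schedule beta ->
  Y 0 = x0 -> Y 1 = y1 -> {within `[0, 1], continuous Y} ->
  (forall t, 0 < t < 1 -> {for t, continuous beta} ->
    is_derive t (1 : R) Y ((beta t / sigma2 beta t) *: (Y t - x0))) ->
  forall t, 0 <= t <= 1 -> Y t = sb_path beta x0 y1 t.
Proof.
move=> hbeta Y0 Y1 cY dY t /andP[]; rewrite le_eqVlt => /predU1P[<- _|t0 t1].
  by rewrite sb_path0.
apply/rowP => i.
(* By the ODE this quotient has zero derivative. It is used on [[t, 1]] only, since [sigma2]
   vanishes at 0; its value at 1 is fixed by [y1]. *)
pose u s := (Y s ord0 i - x0 ord0 i) * (sigma2 beta s)^-1.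
have s_gt0 s : t <= s <= 1 -> 0 < sigma2 beta s.
  by move=> /andP[ts s1]; rewrite sigma2_gt0// (lt_le_trans t0 ts).
have ut : u t = u 1.
  apply: (derive0_countable_cst t1 (beta_countable_not_continuous hbeta)).
    have sub : `[t, 1] `<=` `[0, 1].
      by apply: subset_itvr; rewrite bnd_simp ltW.
    have cY1 := continuous_subspaceW sub cY.
    have cs1 := continuous_subspaceW sub (sigma2_continuous hbeta).
    apply/subspace_continuousP => s st.
    apply: cvgM.
      apply: cvgB; last exact: cvg_cst.
      apply: (cvg_comp Y (fun v : 'rV[R]_d => v ord0 i)).
        exact: (subspace_continuousP _ _).1 cY1 s st.
      exact: coord_continuous.
    apply: cvgV; first by rewrite gt_eqF// s_gt0//; move: st; rewrite /= in_itv.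
    exact: (subspace_continuousP _ _).1 cs1 s st.
  move=> s /andP[ts s1] nD.
  have s01 : 0 < s < 1 by rewrite s1 (lt_trans t0 ts).
  have cs : {for s, continuous beta}.
    by apply: contrapT => ncs; apply: nD; split.
  have dYi := (is_derive_mxP Y s 1 _).1 (dY s s01 cs) ord0 i.
  have ds := is_derive_sigma2 hbeta s01 cs.
  have s0 : sigma2 beta s != 0 by rewrite gt_eqF// s_gt0// !ltW.
  have := is_deriveM (is_deriveB dYi (is_derive_cst (x0 ord0 i) s 1))
    (is_deriveV s0 ds).
  move/is_derive_eq; apply.
  rewrite !mxE fctE /GRing.scale/= subr0 -exprVn.
  rewrite -[(- cst _) s]/(- x0 ord0 i).
  move: (Y s ord0 i - x0 ord0 i) (sigma2 beta s)^-1 (beta s) => a q b.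
  by ring.
move: ut; rewrite /u Y1 => /(congr1 (fun z => z * sigma2 beta t)).
rewrite divfK ?gt_eqF ?s_gt0 ?lexx// => /(canRL (subrK _)) ->.
rewrite /sb_path !mxE addrC; congr (_ + _).
by rewrite [RHS]mulrC mulrA mulrAC.
Qed.

(** * Velocity and solutions of the SB ODE *)

Section main.
Variables (R : realType) (d : nat) (beta : R -> R).
Hypothesis hbeta : noise_schedule beta.

(** The mean does not depend on [eps], so the instance [eps = 1] already identifies [Y t]. *)
Lemma posterior_mean_sb_path (x0 y1 : 'rV[R]_d) (Y : R -> 'rV[R]_d) (t : R)
    (mu : R -> probability (d.-tuple R) R) : 0 < t < 1 ->
  (forall eps, 0 < eps ->
    sb_posterior (fun s => eps * diffusion beta s) t x0 y1 (mu eps) /\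
    has_mean (mu eps) (Y t)) ->
  Y t = sb_path beta x0 y1 t.
Proof.
move=> t01 /(_ 1 ltr01)[Hmu mean].
rewrite sb_path_bridge_mean//; last by case/andP: t01 => *; rewrite !ltW.
apply/rowP => i; rewrite mxE; apply: EFin_inj.
by rewrite -(mean i) (sb_posterior_mean hbeta t01 i ltr01 Hmu).
Qed.

Lemma SB_ODE_velocity (v : R -> 'rV[R]_d -> 'rV[R]_d -> 'rV[R]_d) :
  SB_ODE beta v ->
  forall (t : R) (y x0 : 'rV[R]_d),
    0 < t < 1 -> {for t, continuous beta} ->
    v t y x0 = (beta t / sigma2 beta t) *: (y - x0).
Proof.
move=> Hv t y x0 t01 ct.
have s0 : sigma2 beta t != 0.
  by case/andP: t01 => t0 t1; rewrite gt_eqF// sigma2_gt0// ltW.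
have s1 : sigma2 beta 1 != 0 by rewrite gt_eqF// sigma2_gt0.
(* The end point whose path from [x0] passes through [y] at time [t]. *)
pose y1 := x0 + (sigma2 beta 1 / sigma2 beta t) *: (y - x0).
have [Y [_ _ [_ dY] HY]] := Hv x0 y1.
have YE s : 0 < s < 1 -> Y s = sb_path beta x0 y1 s.
  by move=> s01; have [mu [Hmu _]] := HY s s01; exact: posterior_mean_sb_path Hmu.
have ty : sb_path beta x0 y1 t = y.
  rewrite /sb_path /y1 [x0 + _ - x0]addrC addKr scalerA mulrA divfK// divff// scale1r.
  by rewrite addrC subrK.
have dYt := dY t t01 ct; rewrite YE// ty in dYt.
have dpath := sb_path_is_derive hbeta x0 y1 t01 ct; rewrite ty in dpath.
(* Both sides are now derivatives at [t], of [Y] and of the path, which coincide on the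
   neighbourhood []0, 1[]. *)
rewrite -(@derive_val _ _ _ _ _ _ _ dYt) -(@derive_val _ _ _ _ _ _ _ dpath).
apply: near_eq_derive; near=> s; apply: YE.
suff : s \in `]0, 1[ by rewrite in_itv.
by near: s; apply: near_in_itvoo; rewrite in_itv.
Unshelve. all: by end_near. Qed.

(** [Y] is prescribed on [[0, 1]] only; around an interior time this is a neighbourhood, so the
    derivative carries over from the path. *)
Lemma sb_path_ode_solution (v : R -> 'rV[R]_d -> 'rV[R]_d -> 'rV[R]_d)
    (x0 y1 : 'rV[R]_d) (Y : R -> 'rV[R]_d) :
  (forall (t : R) (y x0 : 'rV[R]_d),
    0 < t < 1 -> {for t, continuous beta} ->
    v t y x0 = (beta t / sigma2 beta t) *: (y - x0)) ->
  (forall t, 0 <= t <= 1 -> Y t = sb_path beta x0 y1 t) ->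
  [/\ Y 0 = x0, Y 1 = y1 & ode_solution beta v x0 Y].
Proof.
move=> vE YE; split.
- by rewrite YE ?lexx ?ler01// sb_path0.
- by rewrite YE ?lexx ?ler01// sb_path1.
split.
  apply: (@subspace_eq_continuous R `[0, 1] _ (sb_path beta x0 y1) Y);
    last exact: sb_path_continuous.
  by move=> t; rewrite inE/= in_itv/= => t01; rewrite YE.
move=> t t01 ct; have t01' : 0 <= t <= 1 by case/andP: t01 => *; rewrite !ltW.
rewrite YE// vE//.
apply: near_eq_is_derive (sb_path_is_derive hbeta x0 y1 t01 ct).
near=> s; apply/esym/YE.
suff : s \in `]0, 1[ by rewrite in_itv/= => /andP[*]; rewrite !ltW.
by near: s; apply: near_in_itvoo; rewrite in_itv.
Unshelve. all: by end_near. Qed.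

Lemma velocity_SB_ODE (v : R -> 'rV[R]_d -> 'rV[R]_d -> 'rV[R]_d) :
  (forall (t : R) (y x0 : 'rV[R]_d),
    0 < t < 1 -> {for t, continuous beta} ->
    v t y x0 = (beta t / sigma2 beta t) *: (y - x0)) ->
  SB_ODE beta v.
Proof.
move=> vE x0 y1; exists (sb_path beta x0 y1).
have [Y0 Y1 odeY] := sb_path_ode_solution vE (fun t _ => erefl (sb_path beta x0 y1 t)).
split => // t t01.
(* Choice needs a measure for every real [eps]; for [eps <= 0], where nothing is required, the
   posterior at [eps = 1] serves as default. *)
have /choice[mu Hmu] : forall eps, exists nu : probability (d.-tuple R) R,
    0 < eps -> sb_posterior (fun s => eps * diffusion beta s) t x0 y1 nu.
  move=> eps; have [e0|e0] := ltP 0 eps.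
    by have [nu] := exists_sb_posterior hbeta x0 y1 t01 e0; exists nu.
  by have [nu _] := exists_sb_posterior hbeta x0 y1 t01 ltr01; exists nu.
have t01' : 0 <= t <= 1 by case/andP: t01 => *; rewrite !ltW.
exists mu; rewrite sb_path_bridge_mean//; split.
  move=> eps e0; split; first exact: Hmu.
  by move=> i; rewrite mxE; exact: sb_posterior_mean (Hmu _ e0).
exact: sb_posterior_concentrates.
Qed.

End main.

Unset Implicit Arguments.
Theorem corollary3p7 (R : realType) (d : nat) (beta : R -> R)
    (hbeta : noise_schedule beta) :
  (forall v : R -> 'rV[R]_d -> 'rV[R]_d -> 'rV[R]_d,
     SB_ODE beta v <->
     (forall (t : R) (y x0 : 'rV[R]_d),
        0 < t < 1 -> {for t, continuous beta} ->
        v t y x0 = (beta t / sigma2 beta t) *: (y - x0))) /\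
  (forall v : R -> 'rV[R]_d -> 'rV[R]_d -> 'rV[R]_d, SB_ODE beta v ->
     forall (x0 y1 : 'rV[R]_d) (Y : R -> 'rV[R]_d),
       [/\ Y 0 = x0, Y 1 = y1 & ode_solution beta v x0 Y] <->
       (forall t : R, 0 <= t <= 1 ->
          Y t = (hsigma2 beta t / (hsigma2 beta t + sigma2 beta t)) *: x0
              + (sigma2 beta t / (hsigma2 beta t + sigma2 beta t)) *: y1)).
Proof.
split=> [v|v Hv x0 y1 Y].
  by split; [exact: SB_ODE_velocity|exact: velocity_SB_ODE].
have vE := SB_ODE_velocity hbeta Hv.
split=> [[Y0 Y1 [cY dY]] t t01|YE].
  rewrite -sb_pathE//; apply: sb_path_unique => // s s01 cs.
  by rewrite -vE//; exact: dY.
by apply: sb_path_ode_solution => // t t01; rewrite YE// sb_pathE.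
Qed.
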